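(* Let $(X,d)$ and $(Y,\rho)$ be $T_1$ quasi-metric spaces, both with the property that forward convergence implies backward convergence. If $(Y,\rho)$ is left K-complete and $A\subseteq X$, then every forward uniformly continuous function $f:(A,d)\to(Y,\rho)$ has a unique extension to a forward uniformly continuous function $\bar f:(Cl^+A,d)\to(Y,\rho)$.
   Context: A quasi-metric on a set $X$ is a function $d:X\times X\to\mathbb{R}$ such that for all $x,y,z\in X$: $d(x,y)\ge 0$ and $d(x,x)=0$; $d(x,y)=0=d(y,x)$ implies $x=y$; and $d(x,y)\le d(x,z)+d(z,y)$ (symmetry is not required). Put $B^+(x,\epsilon)=\{y\in X:d(x,y)<\epsilon\}$; the forward topology $\tau(d)$ is the topology generated by these balls. $(X,d)$ is $T_1$ if $\tau(d)$ is $T_1$ (equivalently, $d(x,y)>0$ whenever $x\ne y$). $Cl^+A$ denotes the closure of $A$ in $\tau(d)$. Subsets carry the restricted quasi-metric, also denoted $d$. A sequence $(x_n)$ is forward convergent to $x$ if $\lim_n d(x,x_n)=0$, and backward convergent to $x$ if $\lim_n d(x_n,x)=0$. The property ''forward convergence implies backward convergence'' means: whenever a sequence is forward convergent to a point, it is backward convergent to that point. A sequence $(x_n)$ is left K-Cauchy if for every $\epsilon>0$ there is $n_0\in\mathbb{N}$ such that $d(x_k,x_n)<\epsilon$ whenever $n_0\le k\le n$. A quasi-metric space is left K-complete if every left K-Cauchy sequence in it is forward convergent to some point of it. A map $f:(X,d)\to(Y,\rho)$ is forward uniformly continuous if for every $\epsilon>0$ there is $\delta>0$ such that $\rho(f(x),f(y))<\epsilon$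 whenever $d(x,y)<\delta$. *)

(* Defs.v *)
From HB Require Import structures.
From mathcomp Require Import all_boot all_order all_algebra.
From mathcomp Require Import all_classical all_reals all_analysis.

Set Implicit Arguments.
Unset Strict Implicit.
Unset Printing Implicit Defensive.

Import Order.TTheory GRing.Theory Num.Theory.
Import numFieldNormedType.Exports.

Local Open Scope classical_set_scope.
Local Open Scope ring_scope.

Record quasi_metric (R : realType) (X : Type) := QuasiMetric {
  qdist :> X -> X -> R ;
  qdist_ge0 : forall x y, 0 <= qdist x y ;
  qdistxx : forall x, qdist x x = 0 ;
  qdist_eq : forall x y, qdist x y = 0 -> qdist y x = 0 -> x = y ;
  qdist_triangle : forall x y z, qdist x y <= qdist x z + qdist z y }.

Definition forward_ball (R : realType) (X : Type) (d : quasi_metric R X)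
  (x : X) (e : R) : set X := [set y | d x y < e].

(* X is not assumed to be a choiceType: the choice structure that
   topologicalType requires comes from classical choice. *)
Definition forward_space (R : realType) (X : Type) (d : quasi_metric R X) :
  Type := X.

Section forward_topology.
Variables (R : realType) (X : Type) (d : quasi_metric R X).

HB.instance Definition _ := gen_eqMixin (forward_space d).
HB.instance Definition _ := gen_choiceMixin (forward_space d).

(* The family of balls is indexed by itself because isSubBaseTopological wants
   a pointed index type, while X may be empty. *)
HB.instance Definition _ := @isSubBaseTopological.Build (forward_space d)
  (set X) [set B | exists x, exists2 e, 0 < e & B = forward_ball d x e] id.

End forward_topology.

Section quasi_metric_notions.
Variables (R : realType) (X : Type) (d : quasi_metric R X).

Definition qT1 : Prop := accessible_space (forward_space d).

Definition forward_closure (A : set X) : set X :=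
  @closure (forward_space d) A.

Lemma subset_forward_closure (A : set X) : A `<=` forward_closure A.
Proof. exact: (@subset_closure (forward_space d)). Qed.

Definition forward_cvg (u : nat -> X) (x : X) : Prop :=
  d x (u n) @[n --> \oo] --> (0 : R).

Definition backward_cvg (u : nat -> X) (x : X) : Prop :=
  d (u n) x @[n --> \oo] --> (0 : R).

Definition forward_cvg_implies_backward_cvg : Prop :=
  forall (u : nat -> X) (x : X), forward_cvg u x -> backward_cvg u x.

Definition left_K_cauchy (u : nat -> X) : Prop :=
  forall e : R, 0 < e -> exists n0 : nat,
    forall k n : nat, (n0 <= k)%N -> (k <= n)%N -> d (u k) (u n) < e.

Definition left_K_complete : Prop :=
  forall u : nat -> X, left_K_cauchy u -> exists x, forward_cvg u x.

Lemma restr_ge0 (A : set X) (x y : A) : 0 <= d (val x) (val y).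
Proof. exact: qdist_ge0. Qed.

Lemma restrxx (A : set X) (x : A) : d (val x) (val x) = 0.
Proof. exact: qdistxx. Qed.

Lemma restr_eq (A : set X) (x y : A) :
  d (val x) (val y) = 0 -> d (val y) (val x) = 0 -> x = y.
Proof. by move=> xy yx; apply: val_inj; exact: qdist_eq xy yx. Qed.

Lemma restr_triangle (A : set X) (x y z : A) :
  d (val x) (val y) <= d (val x) (val z) + d (val z) (val y).
Proof. exact: qdist_triangle. Qed.

Definition restr (A : set X) : quasi_metric R A :=
  QuasiMetric (@restr_ge0 A) (@restrxx A) (@restr_eq A) (@restr_triangle A).

End quasi_metric_notions.

Definition forward_unif_continuous (R : realType) (X Y : Type)
    (d : quasi_metric R X) (rho : quasi_metric R Y) (f : X -> Y) : Prop :=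
  forall e : R, 0 < e -> exists2 delta : R, 0 < delta &
    forall x y : X, d x y < delta -> rho (f x) (f y) < e.

(* Main.v *)
Require Import Defs.
From HB Require Import structures.
From mathcomp Require Import all_boot all_order all_algebra.
From mathcomp Require Import all_classical all_reals all_analysis.
From mathcomp Require Import finmap lra.

Set Implicit Arguments.
Unset Strict Implicit.
Unset Printing Implicit Defensive.

Import Order.TTheory GRing.Theory Num.Theory.
Import numFieldNormedType.Exports.

Local Open Scope classical_set_scope.
Local Open Scope ring_scope.

(** A point x of Cl+ A is the forward limit of a sequence u in A, and by
    hypothesis d(u_n, x) also tends to 0; hence u is left K-Cauchy, and so is
    f o u, which therefore has a limit g(x), again from both sides. Two-sided
    limits are unique and are preserved by forward uniformly continuous maps:
    this gives both that g extends f and that g is the only extension. *)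

Section symmetric_convergence.
Variables (R : realType) (X : Type) (d : quasi_metric R X).

(** Convergence for the symmetrized metric $\max(d(x,y), d(y,x))$, stated so that one index serves
    both inequalities. *)
Definition sym_cvg (u : nat -> X) (x : X) : Prop :=
  forall e : R, 0 < e -> \forall n \near \oo, d x (u n) < e /\ d (u n) x < e.

Lemma forward_cvgP (u : nat -> X) (x : X) : forward_cvg d u x <->
  forall e : R, 0 < e -> \forall n \near \oo, d x (u n) < e.
Proof.
rewrite /forward_cvg cvgr0Pnorm_lt; split => h e e0; move: (h e e0);
  by apply: filterS => n; rewrite ger0_norm ?qdist_ge0.
Qed.

Lemma forward_cvg_sym (u : nat -> X) (x : X) :
  forward_cvg_implies_backward_cvg d -> forward_cvg d u x -> sym_cvg u x.
Proof.
move=> fb ux e e0; have /cvgr0Pnorm_lt/(_ e e0) := fb _ _ ux.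
move/forward_cvgP : ux => /(_ e e0); apply: filterS2 => n.
by rewrite ger0_norm ?qdist_ge0.
Qed.

Lemma qdist_small_eq (x y : X) :
  (forall e : R, 0 < e -> d x y < e /\ d y x < e) -> x = y.
Proof.
move=> h; apply: (@qdist_eq R X d); apply/eqP; rewrite eq_le qdist_ge0 andbT;
  by apply/ler_addgt0Pr => e /h [? ?]; rewrite add0r ltW.
Qed.

Lemma sym_cvg_unique (u : nat -> X) (x y : X) :
  sym_cvg u x -> sym_cvg u y -> x = y.
Proof.
move=> ux uy; apply: qdist_small_eq => e e0.
have e2 : 0 < e / 2 by rewrite divr_gt0.
have [n [[xn nx] [yn ny]]] := filter_ex (filterI (ux _ e2) (uy _ e2)).
have := qdist_triangle d x y (u n); have := qdist_triangle d y x (u n).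
by split; lra.
Qed.

(** In $d(u_k,u_n) \le d(u_k,x) + d(x,u_n)$ the first term is small by backward convergence, the
    second by forward convergence. *)
Lemma sym_cvg_left_K_cauchy (u : nat -> X) (x : X) :
  sym_cvg u x -> left_K_cauchy d u.
Proof.
move=> ux e e0; have e2 : 0 < e / 2 by rewrite divr_gt0.
have [N _ uN] := ux _ e2; exists N => k n Nk kn.
have [_ kx] := uN _ Nk; have [xn _] := uN _ (leq_trans Nk kn).
by have := qdist_triangle d (u k) (u n) x; lra.
Qed.

Lemma nbhs_forward_ball (x : X) (e : R) : 0 < e ->
  @nbhs _ (forward_space d) x (forward_ball d x e).
Proof.
move=> e0; apply: (@open_nbhs_nbhs (forward_space d)); split; last first.
  by rewrite /forward_ball /= qdistxx.
(* Open sets are unions of finite intersections of balls; here both the union and the intersection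
   have a single member. *)
exists [set forward_ball d x e]; last exact: bigcup_set1.
move=> _ ->; exists [fset (forward_ball d x e : set X)]%fset.
  by move=> B; rewrite inE => /eqP ->; apply: mem_set; exists x; exists e.
by rewrite set_fset1 bigcap_set1.
Qed.

Lemma forward_closure_cvg (A : set X) (x : X) : forward_closure d A x ->
  exists u : nat -> A, forward_cvg d (fun n => val (u n)) x.
Proof.
move=> clx.
have approx (n : nat) : {a : A | d x (val a) < n.+1%:R^-1}.
  apply: cid.
  have [a [Aa xa]] : A `&` forward_ball d x n.+1%:R^-1 !=set0.
    by apply: clx; apply: nbhs_forward_ball; rewrite invr_gt0.
  by exists (SigSub (mem_set Aa)).
exists (fun n => sval (approx n)); apply/forward_cvgP => e e0.
apply: filterS (near_infty_natSinv_lt (PosNum e0)) => n /=.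
exact: lt_trans (svalP (approx n)).
Qed.

End symmetric_convergence.

Section uniformly_continuous_maps.
Variables (R : realType) (X Y : Type).
Variables (d : quasi_metric R X) (rho : quasi_metric R Y) (f : X -> Y).
Hypothesis fuc : forward_unif_continuous d rho f.

(** Since [delta] does not depend on the base point, it applies to the pair $(x,u_n)$ and to the
    reversed pair $(u_n,x)$ alike. *)
Lemma forward_unif_continuous_sym_cvg (u : nat -> X) (x : X) :
  sym_cvg d u x -> sym_cvg rho (f \o u) (f x).
Proof.
move=> ux e /fuc [delta delta0 fd]; apply: filterS (ux _ delta0) => n.
by move=> [xn nx]; split; apply: fd.
Qed.

Lemma forward_unif_continuous_left_K_cauchy (u : nat -> X) :
  left_K_cauchy d u -> left_K_cauchy rho (f \o u).
Proof.
move=> uC e /fuc [delta delta0 fd]; have [N uN] := uC _ delta0.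
by exists N => k n Nk kn; apply/fd/uN.
Qed.

End uniformly_continuous_maps.

Theorem theorem5p8 (R : realType) (X Y : Type)
    (d : quasi_metric R X) (rho : quasi_metric R Y)
    (dT1 : qT1 d) (rhoT1 : qT1 rho)
    (dfb : forward_cvg_implies_backward_cvg d)
    (rhofb : forward_cvg_implies_backward_cvg rho)
    (rhoK : left_K_complete rho)
    (A : set X) (f : A -> Y)
    (fuc : forward_unif_continuous (restr d A) rho f) :
  exists! g : forward_closure d A -> Y,
    (forall a : A, g (subfun (@subset_forward_closure _ _ d A) a) = f a) /\
    forward_unif_continuous (restr d (forward_closure d A)) rho g.
Proof.
(* The sequence is chosen together with the limit of its image, because the estimates for [g] go
   back to that same sequence. *)
have lim (x : forward_closure d A) : {uy : (nat -> A) * Y |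
    sym_cvg d (fun n => val (uy.1 n)) (val x) /\ sym_cvg rho (f \o uy.1) uy.2}.
  apply: cid; have [u ux] := forward_closure_cvg (set_valP x).
  have {}ux := forward_cvg_sym dfb ux.
  have uC : left_K_cauchy (restr d A) u := sym_cvg_left_K_cauchy ux.
  have [y uy] := rhoK _ (forward_unif_continuous_left_K_cauchy fuc uC).
  by exists (u, y); split => //; exact: forward_cvg_sym.
pose u x := (sval (lim x)).1; pose g x := (sval (lim x)).2.
have ux x : sym_cvg d (fun n => val (u x n)) (val x) by case: (svalP (lim x)).
have fux x : sym_cvg rho (f \o u x) (g x) by case: (svalP (lim x)).
exists g; split; first split.
- move=> a; set x := subfun _ a.
  (* As [x] is [a] seen in the closure, [f \o u x] tends both to [g x] and to [f a]. *)
  have ua : sym_cvg (restr d A) (u x) a := ux x.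
  exact: sym_cvg_unique (fux x) (forward_unif_continuous_sym_cvg fuc ua).
- move=> e e0; have e3 : 0 < e / 3 by rewrite divr_gt0.
  have [delta delta0 fd] := fuc _ e3; exists delta => // x y /= xy.
  (* Half of the slack in $d(x,y) < \delta$: moving from $x$ to $u_x(n)$ and from $y$ to $u_y(n)$
     costs less than this each, so $d(u_x(n),u_y(n)) < \delta$. *)
  have s0 : 0 < (delta - d (val x) (val y)) / 2 by rewrite divr_gt0// subr_gt0.
  have [n [[[_ nx] [yn _]] [[gxn _] [_ ngy]]]] := filter_ex (filterI
    (filterI (ux x _ s0) (ux y _ s0)) (filterI (fux x _ e3) (fux y _ e3))).
  have /fd /= fuxy : restr d A (u x n) (u y n) < delta.
    have := qdist_triangle d (val (u x n)) (val (u y n)) (val x).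
    have := qdist_triangle d (val x) (val (u y n)) (val y).
    by rewrite /=; lra.
  (* The path from $g(x)$ through $f(u_x(n))$ and $f(u_y(n))$ to $g(y)$ has three legs, each shorter
     than $e/3$. *)
  have := qdist_triangle rho (g x) (g y) (f (u x n)).
  have := qdist_triangle rho (f (u x n)) (g y) (f (u y n)).
  by move: gxn ngy => /=; lra.
- move=> h [hf huc]; apply/funext => x; apply: sym_cvg_unique (fux x) _.
  (* Seen in the closure, [u x] tends to [x], so its image under [h], which is [f \o u x], tends to
     [h x] as well as to [g x]. *)
  have := forward_unif_continuous_sym_cvg huc
    (u := subfun (@subset_forward_closure _ _ d A) \o u x) (ux x).
  by rewrite (_ : h \o _ = f \o u x)//; apply/funext => n /=.
Qed.
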